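(* Let $R$ be a ring, let $\mathcal{X}$ be a class of right $R$-modules closed under isomorphisms, and let $M$ be a right $R$-module with an epimorphic $\mathcal{X}$-cover $p:X\to M$ such that $\mathrm{End}(X)/J(\mathrm{End}(X))$ is a von Neumann regular right self-injective ring and idempotents lift modulo $J(\mathrm{End}(X))$. Let $K$ be the kernel of the ring homomorphism $\varphi:\mathrm{End}(M)\to \mathrm{End}(X)/J(\mathrm{End}(X))$ given by $\varphi(f)=g+J(\mathrm{End}(X))$, where $g\in\mathrm{End}(X)$ is any endomorphism with $p\circ g=f\circ p$. If $M$ is $\mathcal{X}$-automorphism-coinvariant, then $\mathrm{End}(M)/K$ is von Neumann regular, $K=J(\mathrm{End}(M))$, and idempotents lift modulo $J(\mathrm{End}(M))$.
   Context: Rings are associative with identity, modules are unital right modules, $J(-)$ is the Jacobson radical. An $\mathcal{X}$-precover of $M$ is a homomorphism $p:X\to M$ with $X\in\mathcal{X}$ such that every homomorphism $X'\to M$ with $X'\in\mathcal{X}$ factors through $p$. It is an $\mathcal{X}$-cover if, moreover, every endomorphism $h$ of $X$ with $p\circ h=p$ is an automorphism; it is epimorphic if $p$ is an epimorphism. $M$ is $\mathcal{X}$-automorphism-coinvariant if there is an $\mathcal{X}$-cover $p:X\to M$ such that for every automorphism $g$ of $X$ there is an endomorphism $f$ of $M$ with $f\circ p=p\circ g$. The homomorphism $\varphi$ is well defined: $g$ exists because $p$ is a precover, and it is unique modulo $J(\mathrm{End}(X))$. *)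

(* Defs.v *)
From HB Require Import structures.
From mathcomp Require Import all_boot all_order all_algebra.
From mathcomp Require Import generic_quotient ring_quotient.
From mathcomp Require Import boolp.

Set Implicit Arguments.
Unset Strict Implicit.
Unset Printing Implicit Defensive.

Import GRing.Theory Quotient.

Local Open Scope ring_scope.
Local Open Scope quotient_scope.

(* Rings are [pzRingType]s, so that the zero ring is allowed (it occurs as the
   endomorphism ring of the zero module).  A right R-module is a left module
   over the converse ring R^c: (a : R^c) *: v is v multiplied by a on the
   right, since a *: (b *: v) = (a * b : R^c) *: v and a * b in R^c is b * a
   in R. *)
Notation rmodType R := (lmodType R^c).

(* Quotient of a noncommutative ring by a two-sided ideal. The quotient ring
   {ideal_quot _} of ring_quotient is limited to commutative, nonzero rings;
   its additive group {quot I} is general and is reused here. *)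

Record tsideal (R : pzRingType) := TwoSidedIdeal {
  tsideal_pred :> {pred R};
  tsideal_zmod_closed : zmod_closed tsideal_pred;
  tsidealMl : forall a x, x \in tsideal_pred -> a * x \in tsideal_pred;
  tsidealMr : forall a x, x \in tsideal_pred -> x * a \in tsideal_pred
}.

HB.instance Definition _ (R : pzRingType) (I : tsideal R) :=
  GRing.isZmodClosed.Build R (tsideal_pred I) (tsideal_zmod_closed I).

Definition tsideal_zmod (R : pzRingType) (I : tsideal R) : zmodClosed R :=
  GRing.ZmodClosed.clone R (tsideal_pred I) _.

Definition quot_ring (R : pzRingType) (I : tsideal R) : Type :=
  {quot (tsideal_zmod I)}.

Section QuotRing.
Variables (R : pzRingType) (I : tsideal R).

HB.instance Definition _ := GRing.Zmodule.on (quot_ring I).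

Definition quot_proj (x : R) : quot_ring I := \pi_({quot (tsideal_zmod I)}) x.

Lemma quot_proj_eq x y : (quot_proj x == quot_proj y) = (x - y \in I).
Proof. by rewrite idealrBE. Qed.

Lemma quot_projP (u : quot_ring I) : exists x, quot_proj x = u.
Proof. by exists (repr (u : {quot (tsideal_zmod I)})); rewrite /quot_proj reprK. Qed.

Lemma quot_projD x y : quot_proj (x + y) = quot_proj x + quot_proj y.
Proof. exact: pi_add. Qed.

Definition quot_one : quot_ring I := quot_proj 1.

Definition quot_mul (u v : quot_ring I) : quot_ring I :=
  quot_proj (repr (u : {quot (tsideal_zmod I)}) * repr (v : {quot (tsideal_zmod I)})).

Lemma quot_projM x y : quot_proj (x * y) = quot_mul (quot_proj x) (quot_proj y).
Proof.
rewrite /quot_mul; set x' := repr _; set y' := repr _.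
have hx : x - x' \in I by rewrite idealrBE reprK.
have hy : y - y' \in I by rewrite idealrBE reprK.
apply/eqP; rewrite quot_proj_eq.
have -> : x * y - x' * y' = (x - x') * y + x' * (y - y').
  by rewrite mulrBl mulrBr addrA addrNK.
by rewrite rpredD//; [exact: tsidealMr | exact: tsidealMl].
Qed.

Lemma quot_mulA : associative quot_mul.
Proof.
move=> u v w; have [x <-] := quot_projP u; have [y <-] := quot_projP v.
by have [z <-] := quot_projP w; rewrite -!quot_projM mulrA.
Qed.

Lemma quot_mul1 : left_id quot_one quot_mul.
Proof. by move=> u; have [x <-] := quot_projP u; rewrite -quot_projM mul1r. Qed.

Lemma quot_mulr1 : right_id quot_one quot_mul.
Proof. by move=> u; have [x <-] := quot_projP u; rewrite -quot_projM mulr1. Qed.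

Lemma quot_mulDl : left_distributive quot_mul +%R.
Proof.
move=> u v w; have [x <-] := quot_projP u; have [y <-] := quot_projP v.
have [z <-] := quot_projP w.
by rewrite -quot_projD -!quot_projM -quot_projD mulrDl.
Qed.

Lemma quot_mulDr : right_distributive quot_mul +%R.
Proof.
move=> u v w; have [x <-] := quot_projP u; have [y <-] := quot_projP v.
have [z <-] := quot_projP w.
by rewrite -quot_projD -!quot_projM -quot_projD mulrDr.
Qed.

HB.instance Definition _ := GRing.Zmodule_isPzRing.Build (quot_ring I)
  quot_mulA quot_mul1 quot_mulr1 quot_mulDl quot_mulDr.

Lemma quot_proj_is_zmod_morphism : zmod_morphism quot_proj.
Proof.
move=> x y; apply/eqP; rewrite eq_sym subr_eq -quot_projD.
by rewrite subrK.
Qed.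

Lemma quot_proj_is_monoid_morphism : monoid_morphism quot_proj.
Proof. by split=> // x y; exact: quot_projM. Qed.

HB.instance Definition _ :=
  GRing.isZmodMorphism.Build R (quot_ring I) quot_proj quot_proj_is_zmod_morphism.
HB.instance Definition _ :=
  GRing.isMonoidMorphism.Build R (quot_ring I) quot_proj quot_proj_is_monoid_morphism.

End QuotRing.

Arguments quot_proj {R} I x.

Section RKer.
Variables (R S : pzRingType) (f : {rmorphism R -> S}).

Definition rker_pred : {pred R} := fun x => f x == 0.

Lemma rker_zmod_closed : zmod_closed rker_pred.
Proof.
split; first by rewrite unfold_in /rker_pred rmorph0.
move=> x y; rewrite !unfold_in /rker_pred => /eqP fx /eqP fy.
by rewrite rmorphB fx fy subrr.
Qed.

Lemma rkerMl a x : x \in rker_pred -> a * x \in rker_pred.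
Proof. by rewrite !unfold_in /rker_pred rmorphM => /eqP->; rewrite mulr0. Qed.

Lemma rkerMr a x : x \in rker_pred -> x * a \in rker_pred.
Proof. by rewrite !unfold_in /rker_pred rmorphM => /eqP->; rewrite mul0r. Qed.

Definition rker : tsideal R := TwoSidedIdeal rker_zmod_closed rkerMl rkerMr.

End RKer.

Section JacobsonRadical.
Variable R : pzRingType.
Implicit Types m n : {pred R}.

Definition right_ideal m : Prop :=
  zmod_closed m /\ (forall x a, x \in m -> x * a \in m).

Definition maximal_right_ideal m : Prop :=
  [/\ right_ideal m, 1 \notin m &
      forall n, right_ideal n -> 1 \notin n -> {subset m <= n} -> n =i m].

Definition jacobson_pred : {pred R} :=
  fun x => `[< forall m, maximal_right_ideal m -> x \in m >].

Lemma jacobson_zmod_closed : zmod_closed jacobson_pred.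
Proof.
split; first by apply/asboolP => m [[[m0 _] _] _ _].
move=> x y /asboolP hx /asboolP hy; apply/asboolP => m hm.
by have [[[_ mB] _] _ _] := hm; apply: mB; [exact: hx | exact: hy].
Qed.

Lemma jacobsonMr a x : x \in jacobson_pred -> x * a \in jacobson_pred.
Proof.
move=> /asboolP hx; apply/asboolP => m hm.
by have [[_ mM] _ _] := hm; apply: mM; exact: hx.
Qed.

Lemma right_ideal_adjoin m (c : R) : right_ideal m ->
  right_ideal (fun x => `[< exists y a, y \in m /\ x = y + c * a >]).
Proof.
move=> [[m0 mB] mM]; split; first split.
- by apply/asboolP; exists 0, 0; rewrite mulr0 addr0.
- move=> _ _ /asboolP[y [a [ym ->]]] /asboolP[z [b [zm ->]]].
  apply/asboolP; exists (y - z), (a - b); split; first exact: mB.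
  by rewrite mulrBr opprD addrACA.
- move=> _ b /asboolP[y [a [ym ->]]]; apply/asboolP.
  by exists (y * b), (a * b); rewrite mulrDl mulrA; split=> //; exact: mM.
Qed.

Lemma maximal_right_ideal_adjoin m (c : R) :
  maximal_right_ideal m -> c \notin m -> exists y a, y \in m /\ 1 = y + c * a.
Proof.
move=> [mI m1 mmax] cm.
have nI := right_ideal_adjoin c mI.
set n : {pred R} := fun x => _ in nI.
case: (boolP (1 \in n)) => [/asboolP//|n1].
have [[m0 _] _] := mI.
have mn : {subset m <= n}.
  by move=> x xm; apply/asboolP; exists x, 0; rewrite mulr0 addr0.
move: cm; rewrite -(mmax n nI n1 mn) => /negP[].
by apply/asboolP; exists 0, 1; rewrite mulr1 add0r.
Qed.

Lemma jacobsonMl a x : x \in jacobson_pred -> a * x \in jacobson_pred.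
Proof.
move=> /asboolP hx; apply/asboolP => m hm; apply: contrapT => /negP axm.
have [y [b [ym e1]]] := maximal_right_ideal_adjoin hm axm.
have [mI m1 mmax] := hm; have [[m0 mB] mM] := mI.
have am : a \notin m by apply/negP => am; case/negP: axm; exact: mM.
(* the right ideal (m : a) is maximal *)
pose k : {pred R} := fun z => a * z \in m.
have kP z : (z \in k) = (a * z \in m) by [].
have mD u v : u \in m -> v \in m -> u + v \in m.
  by move=> um vm; rewrite -[v]opprK mB// -sub0r mB.
suff kM : maximal_right_ideal k by case/negP: axm; exact: (hx k kM).
split.
- split; first split.
  + by rewrite kP mulr0.
  + by move=> u v; rewrite !kP mulrBr; exact: mB.
  + by move=> u c; rewrite !kP mulrA; exact: mM.
- by rewrite kP mulr1.
- move=> n [[n0 nB] nM] n1 kn z; apply/idP/idP; last exact: kn.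
  move=> zn; rewrite kP; apply: contrapT => /negP azm.
  have [u [c [um e]]] := maximal_right_ideal_adjoin hm azm.
  case/negP: n1; have -> : 1 = (1 - z * c * a) - (- (z * c * a)).
    by rewrite opprK subrK.
  apply: (nB); last by rewrite -sub0r; apply: nB n0 _; rewrite -mulrA; exact: nM.
  apply: kn; rewrite kP mulrBr mulr1 !mulrA.
  have -> : a - a * z * c * a = u * a.
    by rewrite -{1}[a]mul1r {1}e mulrDl addrK.
  exact: mM.
Qed.

Definition jacobson : tsideal R :=
  TwoSidedIdeal jacobson_zmod_closed jacobsonMl jacobsonMr.

Lemma jacobson_quasi_regular x :
  (forall a, exists b, (1 - x * a) * b = 1) -> x \in jacobson.
Proof.
move=> xU; apply/asboolP => m hm; apply: contrapT => /negP xm.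
have [y [a [ym e]]] := maximal_right_ideal_adjoin hm xm.
have [[[_ _] mM] m1 _] := hm; case/negP: m1.
have [b <-] := xU a; apply: mM.
by rewrite e addrK.
Qed.

End JacobsonRadical.

Definition von_neumann_regular (R : pzRingType) : Prop :=
  forall a : R, exists x : R, a = a * x * a.

Definition idempotents_lift_modulo (R : pzRingType) (I : {pred R}) : Prop :=
  forall a : R, a * a - a \in I -> exists e : R, e * e = e /\ e - a \in I.

Definition injective_module (R : pzRingType) (E : lmodType R) : Prop :=
  forall (A B : lmodType R) (i : {linear A -> B}) (f : {linear A -> E}),
    injective i -> exists g : {linear B -> E}, forall x, g (i x) = f x.

(* S^c^o is S acting on itself by right multiplication: in it, a *: x is the
   product of a and x in S^c, that is x * a in S. *)
Definition right_self_injective (S : pzRingType) : Prop :=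
  injective_module (S^c^o : rmodType S).

(* The elements of the ring endo M act on the left of M, and its product is
   composition: (f * g) x = f (g x). *)
Notation endo M := {linear M -> M}.

Section EndoRing.
Variables (R : pzRingType) (M : lmodType R).
Implicit Types f g h : endo M.

HB.instance Definition _ := gen_eqMixin (endo M).
HB.instance Definition _ := gen_choiceMixin (endo M).

Lemma endoP f g : f =1 g -> f = g.
Proof.
move=> fg; have {}fg : f = g :> (M -> M) by exact/funext.
case: f g fg => [f [[fa] [fl]]] [g [[ga] [gl]]] /= fg.
case: _ / fg ga gl => ga gl.
by rewrite (Prop_irrelevance fa ga) (Prop_irrelevance fl gl).
Qed.

Definition endo0 : endo M := \0.
Definition endo1 : endo M := idfun.
Definition endo_opp f : endo M := \- f.
Definition endo_add f g : endo M :=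
  f \+ g.
Definition endo_mul f g : endo M :=
  f \o g.

Lemma endo_addA : associative endo_add.
Proof. by move=> f g h; apply: endoP => x; exact: addrA. Qed.

Lemma endo_addC : commutative endo_add.
Proof. by move=> f g; apply: endoP => x; exact: addrC. Qed.

Lemma endo_add0 : left_id endo0 endo_add.
Proof. by move=> f; apply: endoP => x; exact: add0r. Qed.

Lemma endo_addN : left_inverse endo0 endo_opp endo_add.
Proof. by move=> f; apply: endoP => x; exact: addNr. Qed.

HB.instance Definition _ :=
  GRing.isZmodule.Build (endo M) endo_addA endo_addC endo_add0 endo_addN.

Lemma endo_mulA : associative endo_mul.
Proof. by move=> f g h; exact: endoP. Qed.

Lemma endo_mul1 : left_id endo1 endo_mul.
Proof. by move=> f; exact: endoP. Qed.

Lemma endo_mulr1 : right_id endo1 endo_mul.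
Proof. by move=> f; exact: endoP. Qed.

Lemma endo_mulDl : left_distributive endo_mul +%R.
Proof. by move=> f g h; exact: endoP. Qed.

Lemma endo_mulDr : right_distributive endo_mul +%R.
Proof.
by move=> f g h; apply: endoP => x; exact: raddfD.
Qed.

HB.instance Definition _ := GRing.Zmodule_isPzRing.Build (endo M)
  endo_mulA endo_mul1 endo_mulr1 endo_mulDl endo_mulDr.

Lemma endo0E x : (0 : endo M) x = 0. Proof. by []. Qed.
Lemma endo1E x : (1 : endo M) x = x. Proof. by []. Qed.
Lemma endoNE f x : (- f) x = - f x. Proof. by []. Qed.
Lemma endoDE f g x : (f + g) x = f x + g x. Proof. by []. Qed.
Lemma endoBE f g x : (f - g) x = f x - g x. Proof. by []. Qed.
Lemma endoME f g x : (f * g) x = f (g x). Proof. by []. Qed.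

End EndoRing.

Definition closed_under_iso (R : pzRingType) (XX : lmodType R -> Prop) : Prop :=
  forall (A B : lmodType R) (f : {linear A -> B}), bijective f -> XX A -> XX B.

Section Covers.
Variables (R : pzRingType) (XX : lmodType R -> Prop).

Definition is_precover (M X : lmodType R) (p : {linear X -> M}) : Prop :=
  XX X /\
  forall (X' : lmodType R) (q : {linear X' -> M}), XX X' ->
    exists h : {linear X' -> X}, p \o h =1 q.

Definition is_cover (M X : lmodType R) (p : {linear X -> M}) : Prop :=
  is_precover p /\ forall h : endo X, p \o h =1 p -> bijective h.

Definition automorphism_coinvariant (M : lmodType R) : Prop :=
  exists (X : lmodType R) (p : {linear X -> M}), is_cover p /\
    forall g : endo X, bijective g -> exists f : endo M, f \o p =1 p \o g.

End Covers.

Definition epimorphic (R : pzRingType) (X M : lmodType R)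
    (p : {linear X -> M}) : Prop :=
  forall y, exists x, p x = y.

Section CoverMorphism.
Variables (R : pzRingType) (XX : lmodType R -> Prop) (M X : lmodType R).
Variables (p : {linear X -> M}) (hp : is_cover XX p).

Lemma cover_lift_exists (f : endo M) : exists g : endo X, p \o g =1 f \o p.
Proof.
have [[hX hpre] _] := hp.
by have [g hg] := hpre X (f \o p) hX; exists g.
Qed.

Lemma cover_ker_jacobson (h : endo X) :
  (forall x, p (h x) = 0) -> h \in jacobson (endo X).
Proof.
move=> ph; apply: jacobson_quasi_regular => a.
have [_ hiso] := hp.
have pk : p \o (1 - h * a) =1 p by move=> x; rewrite /= raddfB /= ph subr0.
move: pk; set k : endo X := 1 - h * a => /hiso[b ab ba].
have bl : linear b.
  by move=> c u v; apply: (can_inj ab); rewrite linearP !ba.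
pose B := GRing.isLinear.Build R X X *:%R b bl.
pose b' : endo X := (HB.pack b B : {linear X -> X}).
by exists b'; apply: endoP => x; exact: ba.
Qed.

(* f is sent to the class of a chosen lift g of f along p; by [cover_phiE] any
   lift gives the same class. *)
Definition cover_phi (f : endo M) : quot_ring (jacobson (endo X)) :=
  quot_proj (jacobson (endo X)) (sval (cid (cover_lift_exists f))).

Lemma cover_phiE (f : endo M) (g : endo X) :
  p \o g =1 f \o p -> cover_phi f = quot_proj (jacobson (endo X)) g.
Proof.
move=> pg; rewrite /cover_phi; case: cid => g' /= pg'.
apply/eqP; rewrite quot_proj_eq; apply: cover_ker_jacobson => x.
rewrite /= raddfB /=; have /= -> := pg x; have /= -> := pg' x.
by rewrite subrr.
Qed.

Lemma cover_phi_is_zmod_morphism : zmod_morphism cover_phi.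
Proof.
move=> f1 f2; have [g1 h1] := cover_lift_exists f1.
have [g2 h2] := cover_lift_exists f2.
rewrite (cover_phiE h1) (cover_phiE h2) -rmorphB; apply: cover_phiE => x /=.
by rewrite raddfB /=; have /= -> := h1 x; have /= -> := h2 x.
Qed.

Lemma cover_phi_is_monoid_morphism : monoid_morphism cover_phi.
Proof.
split; first by rewrite -(rmorph1 (quot_proj (jacobson (endo X)))); exact: cover_phiE.
move=> f1 f2; have [g1 h1] := cover_lift_exists f1.
have [g2 h2] := cover_lift_exists f2.
rewrite (cover_phiE h1) (cover_phiE h2) -rmorphM; apply: cover_phiE => x /=.
by have /= -> := h1 (g2 x); have /= -> := h2 x.
Qed.

HB.instance Definition _ := GRing.isZmodMorphism.Build
  (endo M) ((quot_ring (jacobson (endo X)))) cover_phi cover_phi_is_zmod_morphism.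
HB.instance Definition _ := GRing.isMonoidMorphism.Build
  (endo M) ((quot_ring (jacobson (endo X)))) cover_phi cover_phi_is_monoid_morphism.

End CoverMorphism.

(* Main.v *)
(* Let S = End(X)/J(End(X)). Automorphism-coinvariance says that the image T of
   phi is a subring of S containing all units of S, and the heart of the proof
   is that every a in S then has an inner inverse in T; regularity of
   End(M)/K follows at once.

   Elements of square zero generate two-sided ideals contained in T. Given
   a = aba and b = bab, comparability of the complements (1 - ba)S and
   (1 - ab)S of bS and aS yields partial inverses u, v such that u is
   an inner inverse of a and the defects 1 - uv and 1 - vu are orthogonal. The
   defect e = 1 - uv produces the shift e S, ueS, u^2eS, ...; splitting it into
   even and odd terms shows that the projection onto its injective hull lies in
   an ideal contained in T. Outside the hulls for both defects u is invertible,
   so u is in T.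

   The units of End(X) descend to M, hence so do the elements of J(End(X)), and
   therefore a lifted idempotent of End(X) descends to an idempotent of
   End(M). *)
From HB Require Import structures.
Require Import Defs.
From mathcomp Require Import all_boot all_order all_algebra.
From mathcomp Require Import boolp classical_sets.

Set Implicit Arguments.
Unset Strict Implicit.
Unset Printing Implicit Defensive.

Import GRing.Theory.

Local Open Scope ring_scope.

(** * Submodules, Zorn's lemma and partial homomorphisms into injective modules *)

Section Submodules.
Variables (K : pzRingType) (V : lmodType K).
Implicit Types (A N : set V).

Definition submod A := A 0 /\ forall c x y, A x -> A y -> A (c *: x + y).

Lemma submodD A x y : submod A -> A x -> A y -> A (x + y).
Proof. by move=> [_ h] Ax Ay; rewrite -[x]scale1r; exact: h. Qed.

Lemma submodZ A c x : submod A -> A x -> A (c *: x).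
Proof. by move=> [A0 h] Ax; rewrite -[_ *: _]addr0; exact: h. Qed.

Lemma submodB A x y : submod A -> A x -> A y -> A (x - y).
Proof. by move=> [_ h] Ax Ay; rewrite addrC -scaleN1r; exact: h. Qed.

Lemma submod_adjoin A v : submod A ->
  submod [set x | exists a c, A a /\ x = a + c *: v]%classic.
Proof.
move=> Asub; have [A0 AL] := Asub; split; first by exists 0, 0; rewrite scale0r addr0.
move=> d _ _ [a [c [Aa ->]]] [b [e [Ab ->]]].
exists (d *: a + b), (d * c + e); split; first exact: AL.
by rewrite scalerDr scalerDl scalerA addrACA.
Qed.

(** The choice of the forbidden set [N] yields complements, maximal right ideals or maximal partial
    isomorphisms. *)
Lemma max_submod A N : submod A -> (forall x, A x -> ~ N x) ->
  exists B, [/\ submod B, forall x, A x -> B x, forall x, B x -> ~ N x &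
    forall v, ~ B v -> exists b c, B b /\ N (b + c *: v)].
Proof.
move=> Asub AN.
(* the empty set is allowed because [Zorn_bigcup] also considers the empty chain *)
pose P (B : set V) := (forall x, ~ B x) \/
  [/\ submod B, forall x, A x -> B x & forall x, B x -> ~ N x].
have [|B [PB Bmax]] := @Zorn_bigcup _ P.
  move=> F FP Ftot.
  have [[X0 [FX0 [x0 X0x0]]]|Fe] := pselect (exists X, F X /\ exists x, X x); last first.
    by left=> x [X FX Xx]; apply: Fe; exists X; split=> //; exists x.
  right.
  have FF X x : F X -> X x -> [/\ submod X, forall x, A x -> X x & forall x, X x -> ~ N x].
    by move=> FX Xx; case: (FP _ FX) => // /(_ x).
  have [X0sub AX0 _] := FF _ _ FX0 X0x0.
  split; first split.
  - by exists X0 => //; case: X0sub.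
  - move=> c x y [X FX Xx] [Y FY Yy].
    have [[_ Xs] _ _] := FF _ _ FX Xx; have [[_ Ys] _ _] := FF _ _ FY Yy.
    case: (Ftot X Y FX FY) => XY.
      by exists Y => //; apply: Ys => //; exact: XY.
    by exists X => //; apply: Xs => //; exact: XY.
  - by move=> x Ax; exists X0 => //; exact: AX0.
  - by move=> x [X FX Xx]; have [_ _] := FF _ _ FX Xx; apply.
have PA : P A by right; split.
have {PB} [Bsub AB BN] : [/\ submod B, forall x, A x -> B x & forall x, B x -> ~ N x].
  case: PB => // Be; exfalso; apply: Bmax PA; split; first by move=> x /Be.
  by move=> /(_ 0 (proj1 Asub)); exact: Be.
exists B; split=> // v nBv; apply: contrapT => nh.
have [B0 BL] := Bsub.
apply: (Bmax [set x | exists a c, B a /\ x = a + c *: v]%classic).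
  split; first by move=> x Bx; exists x, 0; rewrite scale0r addr0.
  by move=> sub; apply/nBv/sub; exists 0, 1; rewrite scale1r add0r.
right; split; first exact: submod_adjoin.
- by move=> x /AB Bx; exists x, 0; rewrite scale0r addr0.
- by move=> _ [a [c [Ba ->]]] Nac; apply: nh; exists a, c.
Qed.

End Submodules.

Section SubmoduleType.
Variables (K : pzRingType) (V : lmodType K) (A : set V) (Asub : submod A).

Definition submod_pred : {pred V} := fun x => `[< A x >].

Lemma submod_pred_closed : submod_closed submod_pred.
Proof.
have [A0 AL] := Asub; split; first exact/asboolP.
by move=> c x y /asboolP Ax /asboolP Ay; apply/asboolP; exact: AL.
Qed.

Definition submod_type of submod A := {x | submod_pred x}.
Local Notation T := (submod_type Asub).

HB.instance Definition _ := Choice.on T.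
HB.instance Definition _ := SubType.on T.
HB.instance Definition _ := GRing.SubChoice_isSubLmodule.Build K V submod_pred T
   submod_pred_closed.
End SubmoduleType.

(* A submodule [G] of [V * E] with [(0, y) \in G -> y = 0] is the graph of a
   homomorphism to [E] defined on a submodule of [V]. *)
Lemma injective_graph (K : pzRingType) (V E : lmodType K) (G : set (V * E)%type) :
  injective_module E -> submod G -> (forall y, G (0, y) -> y = 0) ->
  exists g : {linear V -> E}, forall x y, G (x, y) -> g x = y.
Proof.
move=> Einj Gsub G0; pose T := submod_type Gsub.
have il : linear (fun t : T => (val t).1) by move=> c t u; rewrite linearP.
have fl : linear (fun t : T => (val t).2) by move=> c t u; rewrite linearP.
pose i : {linear T -> V} := HB.pack (fun t : T => (val t).1)
  (GRing.isLinear.Build _ _ _ _ _ il).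
pose f : {linear T -> E} := HB.pack (fun t : T => (val t).2)
  (GRing.isLinear.Build _ _ _ _ _ fl).
have iI : injective i.
  move=> t t' e; apply/eqP; rewrite -subr_eq0; apply/eqP/val_inj.
  have e1 : (val (t - t')).1 = 0.
    by move/eqP: e; rewrite -subr_eq0 -linearB => /eqP.
  have /asboolP : submod_pred G (val (t - t')) := valP (t - t').
  rewrite [RHS]linear0; move: e1; case: (val (t - t')) => a b /= -> /G0 -> //.
have [g gE] := Einj _ _ i f iI.
exists g => x y Gxy.
have Pxy : submod_pred G (x, y) by apply/asboolP.
exact: (gE (exist _ (x, y) Pxy)).
Qed.

(** * Right ideals, the Jacobson radical and left multiplications *)

Section RightIdeals.
Variable S : pzRingType.
Implicit Types (A B : set S) (x y r : S).

Definition rideal A := @submod S^c (S^c^o : lmodType S^c) A.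

Lemma rideal_intro A : A 0 -> (forall x y, A x -> A y -> A (x + y)) ->
  (forall x r, A x -> A (x * r)) -> rideal A.
Proof. by move=> A0 AD AM; split=> // c x y Ax Ay; apply: AD => //; exact: AM. Qed.

Lemma rideal0 A : rideal A -> A 0. Proof. by case. Qed.

Lemma ridealD A x y : rideal A -> A x -> A y -> A (x + y).
Proof. exact: submodD. Qed.

Lemma ridealB A x y : rideal A -> A x -> A y -> A (x - y).
Proof. exact: submodB. Qed.

Lemma ridealM A x r : rideal A -> A x -> A (x * r).
Proof. exact: (@submodZ _ (S^c^o : lmodType S^c)). Qed.

Lemma rideal_trivial : rideal [set 0]%classic.
Proof. by apply: rideal_intro => [//|x y -> ->|x r ->] /=; rewrite ?addr0 ?mul0r. Qed.

Lemma max_rideal A (N : set S) : rideal A -> (forall x, A x -> ~ N x) ->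
  exists B, [/\ rideal B, forall x, A x -> B x, forall x, B x -> ~ N x &
    forall v, ~ B v -> exists b r, B b /\ N (b + v * r)].
Proof. exact: (@max_submod _ (S^c^o : lmodType S^c)). Qed.

(** Otherwise [(1 - x) S] lies in a maximal right ideal, which also contains [x] and hence [1]. *)
Lemma one_sub_jacobson_rinv x : x \in jacobson S -> exists y, (1 - x) * y = 1.
Proof.
move=> /asboolP xJ; apply: contrapT => ninv.
have Asub : rideal [set z | exists y, z = (1 - x) * y]%classic.
  apply: rideal_intro => [|_ _ [y ->] [z ->]|_ r [y ->]].
  - by exists 0; rewrite mulr0.
  - by exists (y + z); rewrite mulrDr.
  - by exists (y * r); rewrite mulrA.
have [|m [mI Am m1 mmax]] := @max_rideal _ [set 1]%classic Asub.
  by move=> z [y ->] e; apply: ninv; exists y.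
pose m' : {pred S} := fun z => `[< m z >].
have m'max : maximal_right_ideal m'.
  split.
  - split; first split.
    + by apply/asboolP; exact: rideal0.
    + by move=> u v /asboolP mu /asboolP mv; apply/asboolP; exact: ridealB.
    + by move=> u c /asboolP mu; apply/asboolP; exact: ridealM.
  - by apply/asboolP => /m1; exact.
  - move=> n [[n0 nB] nM] n1 mn z; apply/idP/idP => [zn|/mn//].
    apply/asboolP; apply: contrapT => /mmax[b [r [/asboolP mb e]]].
    have nN v : v \in n -> - v \in n by rewrite -[- v]sub0r; exact: nB.
    by case/negP: n1; rewrite -e -[z * r]opprK; apply: nB; [exact: mn|exact/nN/nM].
have /asboolP mx : x \in m' := xJ _ m'max.
apply: (m1 1) => //; rewrite -[1](subrK x).
by apply: ridealD => //; apply: Am; exists 1; rewrite mulr1.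
Qed.

Hypothesis Sinj : right_self_injective S.

(** Self-injectivity extends the partial map with graph [G] to all of [S], and an endomorphism of
    the right module [S] is left multiplication by its value at [1]. *)
Lemma graph_lmul (G : set (S^c^o * S^c^o)%type) : submod G ->
  (forall y, G (0, y) -> y = 0) ->
  exists s : S, forall x y : S, G (x, y) -> s * x = y.
Proof.
move=> Gsub G0; have [g gE] := injective_graph Sinj Gsub G0.
exists (g (1 : S)) => x y /gE <-.
by rewrite -{2}[x : S]mul1r; exact/esym/(linearZ_LR g (x : S^c) (1 : S)).
Qed.

End RightIdeals.

(** * Hulls and comparability in regular right self-injective rings *)

Section RegularSelfInjective.
Variable S : pzRingType.
Hypotheses (Sreg : von_neumann_regular S) (Sinj : right_self_injective S).
Implicit Types (A B : set S) (e f r x y : S).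

Lemma regular_eq0 x : (forall y, x * y * x = 0) -> x = 0.
Proof. by move=> h; have [y ->] := Sreg x; exact: h. Qed.

(** Regular rings are semiprime, and [(y r x) d (y r x)] contains the factor [x d y = 0]. *)
Lemma orthogonal_sym x y :
  (forall r, x * r * y = 0) -> forall r, y * r * x = 0.
Proof.
move=> xy r; apply: regular_eq0 => d.
have -> : y * r * x * d * (y * r * x) = y * r * (x * d * y) * (r * x).
  by rewrite !mulrA.
by rewrite xy mulr0 mul0r.
Qed.

(* Left multiplication by [h] is the projection onto the injective hull of [A]
   in [S] along a complement containing [B]. *)
Lemma hull A B : rideal A -> rideal B ->
  (forall x, A x -> B x -> x = 0) ->
  exists h, [/\ forall x, A x -> h * x = x, forall x, B x -> h * x = 0 &
    forall y, (forall x, A x -> y * x = 0) -> y * h = 0].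
Proof.
move=> Aid Bid AB.
have [|C [Cid BC AC Cmax]] := @max_rideal _ B (fun x => A x /\ x <> 0) Bid.
  by move=> x Bx [Ax]; apply; exact: AB.
have {}AC x : A x -> C x -> x = 0.
  by move=> Ax Cx; apply: contrapT => x0; exact: (AC x).
(* The graph of the projection of [A + C] onto [A] along [C]. *)
pose G (u : S^c^o * S^c^o) := A u.2 /\ C ((u.1 : S) - (u.2 : S)).
have [||h hE] := @graph_lmul S Sinj G.
- split; first by split; [exact: (rideal0 Aid) | rewrite subrr; exact: (rideal0 Cid)].
  move=> c [x1 x2] [y1 y2] [/= Ax Cx] [/= Ay Cy]; split.
    exact: (proj2 Aid).
  have -> : (c *: x1 + y1 : S) - (c *: x2 + y2 : S) =
            ((x1 : S) - (x2 : S)) * (c : S) + ((y1 : S) - (y2 : S)).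
    by rewrite mulrBl opprD addrACA.
  by apply: ridealD => //; exact: ridealM.
- move=> y [/= Ay Cy]; apply: AC => //.
  have -> : y = (0 - (0 - (y : S))) by rewrite !sub0r opprK.
  by apply: ridealB => //; exact: rideal0.
have hA x : A x -> h * x = x.
  by move=> Ax; apply: hE; split=> //=; rewrite subrr; exact: rideal0.
have hC x : C x -> h * x = 0.
  by move=> Cx; apply: hE; split=> /=; rewrite ?subr0 //; exact: rideal0.
exists h; split=> // [x Bx|y yA]; first by apply: hC; exact: BC.
(* If [y h] is nonzero, the idempotent [g] is outside [C], and maximality puts some nonzero
   [c + g r] in [A]. Since [g] kills [A] and [C], this forces [g r = 0], so [c] lies in both [A] and
   [C]. *)
have [w yw] := Sreg (y * h); set g := w * (y * h).
have gA x : A x -> g * x = 0 by move=> Ax; rewrite -!mulrA hA // yA ?mulr0.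
have gC x : C x -> g * x = 0 by move=> Cx; rewrite -!mulrA hC // !mulr0.
have yg : y * h * g = y * h by rewrite /g mulrA.
have gg : g * g = g by rewrite {1}/g -mulrA yg.
have [Cg|/Cmax[c [r [Cc [Acr]]]]] := pselect (C g); first by rewrite -yg -gg gC ?mulr0.
have gr : g * r = 0.
  by have := gA _ Acr; rewrite mulrDr gC // add0r mulrA gg.
by rewrite gr addr0 in Acr *; case; exact: AC.
Qed.

Lemma hull_idempotent A h : (forall x, A x -> h * x = x) ->
  (forall y, (forall x, A x -> y * x = 0) -> y * h = 0) -> h * h = h.
Proof.
move=> hA hM; apply/eqP; rewrite -subr_eq0; apply/eqP.
rewrite -[X in _ - X]mul1r -mulrBl; apply: hM => x Ax.
by rewrite mulrBl hA // mul1r subrr.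
Qed.

(* Weak form of general comparability: [t * s] and [s * t] are equivalent
   idempotents below [e] and [f]. *)
Lemma comparability e f : e * e = e -> f * f = f ->
  exists s t, [/\ s = f * s * e, t = e * t * f,
    s = s * t * s, t = t * s * t &
    forall r, (f - s * t) * r * (e - t * s) = 0].
Proof.
move=> ee ff.
(* Avoiding [N] makes [G] the graph of an isomorphism from a right ideal inside [e S] onto one
   inside [f S]; Zorn's lemma makes it maximal. *)
pose N (u : S^c^o * S^c^o) :=
  [\/ (u.1 = 0 /\ u.2 <> 0), (u.2 = 0 /\ u.1 <> 0) |
    ~ (e * u.1 = u.1 :> S /\ f * u.2 = u.2 :> S)].
have [||G [Gsub _ GN Gmax]] := @max_submod _ (S^c^o * S^c^o : lmodType S^c)%type [set 0]%classic N.
- by split=> // c x y -> ->; rewrite scaler0 addr0.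
- by move=> x -> [[_ []]|[_ []]|[]] //=; split; exact: mulr0.
have G1 y : G (0, y) -> y = 0.
  by move=> Gy; apply: contrapT => y0; apply: (GN _ Gy); constructor 1.
have G2 x : G (x, 0) -> x = 0.
  by move=> Gx; apply: contrapT => x0; apply: (GN _ Gx); constructor 2.
have G3 (x y : S) : G (x, y) -> e * x = x /\ f * y = y.
  by move=> Gxy; apply: contrapT => nxy; apply: (GN _ Gxy); constructor 3.
have [s sG] := graph_lmul Sinj Gsub G1.
pose G' (u : S^c^o * S^c^o) := G (u.2, u.1).
have [||t tG] := @graph_lmul S Sinj G'.
- by case: Gsub => G0 GL; split=> // c [x1 x2] [y1 y2]; exact: GL.
- exact: G2.
pose A : set S := fun x => exists y, G (x, y).
pose B : set S := fun y => exists x, G (x, y).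
have GD (x y x' y' : S) : G (x, y) -> G (x', y') -> G (x + x', y + y').
  exact: (@submodD S^c (S^c^o * S^c^o)%type G (x, y) (x', y') Gsub).
have GM (x y r : S) : G (x, y) -> G (x * r, y * r) .
  exact: (@submodZ S^c (S^c^o * S^c^o)%type G (r : S^c) (x, y) Gsub).
have Aid : rideal A.
  apply: rideal_intro => [|x x' [y h] [y' h']|x r [y h]].
  - by exists 0; case: Gsub.
  - by exists (y + y'); exact: GD.
  - by exists (y * r); exact: GM.
have Bid : rideal B.
  apply: rideal_intro => [|x x' [y h] [y' h']|x r [y h]].
  - by exists 0; case: Gsub.
  - by exists (y + y'); exact: GD.
  - by exists (y * r); exact: GM.
have [e' [e'A _ e'M]] := hull Aid (@rideal_trivial S) (fun _ _ h => h).
have [f' [f'B _ f'M]] := hull Bid (@rideal_trivial S) (fun _ _ h => h).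
(* [e1], [f1] are hulls of [A], [B] below [e], [f] *)
pose e1 := e' * e; pose f1 := f' * f.
have ee' : e * e' = e'.
  apply/eqP; rewrite -subr_eq0 -[X in _ - X]mul1r -mulrBl; apply/eqP/e'M.
  by move=> x [y /G3[ex _]]; rewrite mulrBl mul1r ex subrr.
have ff' : f * f' = f'.
  apply/eqP; rewrite -subr_eq0 -[X in _ - X]mul1r -mulrBl; apply/eqP/f'M.
  by move=> x [y /G3[_ ex]]; rewrite mulrBl mul1r ex subrr.
have e1A x : A x -> e1 * x = x.
  by move=> Ax; have [y /G3[ex _]] := Ax; rewrite -mulrA ex e'A.
have f1B x : B x -> f1 * x = x.
  by move=> Bx; have [y /G3[_ fx]] := Bx; rewrite -mulrA fx f'B.
have e1M y : (forall x, A x -> y * x = 0) -> y * e1 = 0.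
  by move=> /e'M h; rewrite mulrA h mul0r.
have f1M y : (forall x, B x -> y * x = 0) -> y * f1 = 0.
  by move=> /f'M h; rewrite mulrA h mul0r.
have e1M' y y' : (forall x, A x -> y * x = y' * x) -> y * e1 = y' * e1.
  move=> h; apply/eqP; rewrite -subr_eq0 -mulrBl; apply/eqP/e1M => x /h hx.
  by rewrite mulrBl hx subrr.
have f1M' y y' : (forall x, B x -> y * x = y' * x) -> y * f1 = y' * f1.
  move=> h; apply/eqP; rewrite -subr_eq0 -mulrBl; apply/eqP/f1M => x /h hx.
  by rewrite mulrBl hx subrr.
have e1e1 : e1 * e1 = e1 := hull_idempotent e1A e1M.
have f1f1 : f1 * f1 = f1 := hull_idempotent f1B f1M.
have ee1 : e * e1 = e1 by rewrite mulrA ee'.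
have ff1 : f * f1 = f1 by rewrite mulrA ff'.
have e1e : e1 * e = e1 by rewrite -mulrA ee.
have f1f : f1 * f = f1 by rewrite -mulrA ff.
have sA x : A x -> B (s * x) by move=> [y h]; rewrite (sG _ _ h); exists x.
have tB y : B y -> A (t * y) by move=> [x h]; rewrite (tG _ _ h); exists y.
have ts x : A x -> t * (s * x) = x.
  by move=> [y h]; rewrite (sG _ _ h) (tG _ _ h).
have st y : B y -> s * (t * y) = y.
  by move=> [x h]; rewrite (tG _ _ h) (sG _ _ h).
have fse : f1 * s * e1 = s * e1 by apply: e1M' => x /sA Bx; rewrite -mulrA f1B.
have etf : e1 * t * f1 = t * f1 by apply: f1M' => x /tB Ax; rewrite -mulrA e1A.
have tse : t * s * e1 = e1.
  by rewrite -[RHS]mul1r; apply: e1M' => x Ax; rewrite -mulrA ts // mul1r.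
have stf : s * t * f1 = f1.
  by rewrite -[RHS]mul1r; apply: f1M' => x Bx; rewrite -mulrA st // mul1r.
have E1 : t * f1 * (s * e1) = e1 by rewrite -mulrA [f1 * _]mulrA fse mulrA tse.
have F1 : s * e1 * (t * f1) = f1 by rewrite -mulrA [e1 * _]mulrA etf mulrA stf.
exists (s * e1), (t * f1); rewrite E1 F1; split.
- by rewrite -{1}fse -{1}ff1 -{1}e1e -fse !mulrA.
- by rewrite -{1}etf -{1}ee1 -{1}f1f -etf !mulrA.
- by rewrite mulrA fse.
- by rewrite mulrA etf.
(* A nonzero [c = c d' c] would let the pair [(d' c, c)] extend the isomorphism: [e1] and [f1] kill
   its components but fix [A] and [B]. *)
move=> r; set c := _ * r * _; apply: contrapT => c0.
have [d cd] := Sreg c.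
have fc : (f - f1) * c = c.
  by rewrite /c !mulrA; congr (_ * _ * _);
    rewrite mulrBl !mulrBr ff ff1 f1f f1f1 subrr subr0.
have ce : c * (e - e1) = c.
  by rewrite /c -mulrA; congr (_ * _);
    rewrite mulrBl !mulrBr ee ee1 e1e e1e1 subrr subr0.
pose d' := (e - e1) * d.
have cd' : c * d' * c = c by rewrite /d' mulrA ce -cd.
have ed : e * d' = d' by rewrite mulrA mulrBr ee ee1.
have e1d : e1 * d' = 0 by rewrite mulrA mulrBr e1e e1e1 subrr mul0r.
have fc' : f * c = c by rewrite -fc mulrA mulrBr ff ff1.
have f1c : f1 * c = 0 by rewrite -fc mulrA mulrBr f1f f1f1 subrr mul0r.
clearbody d'; clear cd; clearbody c.
clear fc ce.
have nG : ~ G (d' * c, c).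
  move=> h; apply: c0; rewrite -cd' -mulrA -[d' * c]e1A; last by exists c.
  by rewrite [e1 * _]mulrA e1d mul0r mulr0.
have [[x y] [z [Gxy]]] := Gmax _ nG.
have [ex fy] := G3 _ _ Gxy.
have e1x : e1 * x = x by apply: e1A; exists y.
have f1y : f1 * y = y by apply: f1B; exists x.
change (N ((x : S) + d' * c * z, (y : S) + c * z) -> False).
case=> /= [[h1 h2]|[h1 h2]|h].
- have x0 : (x : S) = 0.
    have : e1 * ((x : S) + d' * c * z) = 0 by rewrite h1 mulr0.
    by rewrite mulrDr !mulrA e1d !mul0r addr0 e1x.
  have y0 : (y : S) = 0 by apply: G1; rewrite -[X in (X, _)]x0.
  move: h1 h2; rewrite x0 y0 !add0r => h1; apply.
  by rewrite -cd' -mulrA -mulrA [d' * _]mulrA h1 mulr0.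
- have y0 : (y : S) = 0.
    have : f1 * ((y : S) + c * z) = 0 by rewrite h1 mulr0.
    by rewrite mulrDr !mulrA f1c mul0r addr0 f1y.
  have x0 : (x : S) = 0 by apply: G2; rewrite -[X in (_, X)]y0.
  move: h1 h2; rewrite x0 y0 !add0r => h1; apply.
  by rewrite -mulrA h1 mulr0.
- apply: h; split; first by rewrite mulrDr ex !mulrA ed.
  by rewrite mulrDr fy mulrA fc'.
Qed.

(** * Inner inverses in a subring containing all units *)

Variable T : set S.
Hypotheses (Tunit : forall x y, x * y = 1 -> y * x = 1 -> T x)
  (TD : forall x y, T x -> T y -> T (x + y))
  (TM : forall x y, T x -> T y -> T (x * y)).

Lemma unit_spanN x : T x -> T (- x).
Proof.
move=> Tx; rewrite -mulN1r; apply: TM => //.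
by apply: (@Tunit _ (-1)); rewrite mulrNN mulr1.
Qed.

(** [x = (1 + x) - 1], and [1 + x] has inverse [1 - x]. *)
Lemma unit_span_sqr0 x : x * x = 0 -> T x.
Proof.
move=> xx; have -> : x = 1 + x + - 1 by rewrite addrC addrA addNr add0r.
apply: TD; last by apply/unit_spanN/(@Tunit _ 1); rewrite mulr1.
apply: (@Tunit _ (1 - x)).
  by rewrite mulrDl mul1r mulrBr mulr1 xx subr0 subrK.
by rewrite mulrBl mul1r mulrDr mulr1 xx addr0 addrK.
Qed.

(* The corners of an idempotent [g], except [g S g], consist of elements of
   square zero; if [g = c q] with [g q = 0], then [g S g = (g S c) q] consists
   of products of two such elements. *)
Lemma unit_span_ideal_sqr0 q : q * q = 0 -> forall r r', T (r * q * r').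
Proof.
move=> qq r r'; have [c qc] := Sreg q; set g := c * q.
have gg : g * g = g by rewrite /g -[c * q * _]mulrA [q * _]mulrA -qc.
have gq : g * q = 0 by rewrite -mulrA qq mulr0.
have qg : q * g = q by rewrite mulrA -qc.
pose c' := g * c * (1 - g).
have c'q : c' * q = g.
  by rewrite -mulrA mulrBl mul1r gq subr0 -mulrA.
have c'g : c' * g = 0 by rewrite -mulrA mulrBl mul1r gg subrr mulr0.
have g1g : g * (1 - g) = 0 by rewrite mulrBr mulr1 gg subrr.
have g1g' : (1 - g) * g = 0 by rewrite mulrBl mul1r gg subrr.
clearbody c'; clearbody g.
have Tgg y : T (g * y * g).
  rewrite -{2}c'q mulrA; apply: TM; last exact: unit_span_sqr0.
  apply: unit_span_sqr0.
  by rewrite -mulrA [c' * _]mulrA [c' * _]mulrA c'g !mul0r mulr0.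
have Tgr y : T (g * y).
  have -> : g * y = g * y * g + g * y * (1 - g) by rewrite -mulrDr addrC subrK mulr1.
  apply: TD => //.
  apply: unit_span_sqr0.
  by rewrite -!mulrA [(1 - g) * _]mulrA g1g' !(mulr0, mul0r).
have Trg y : T (y * g).
  have -> : y * g = g * (y * g) + (1 - g) * (y * g) by rewrite -mulrDl addrC subrK mul1r.
  apply: TD; first by rewrite mulrA.
  apply: unit_span_sqr0.
  by rewrite -!mulrA [g * ((1 - g) * _)]mulrA g1g !(mulr0, mul0r).
have -> : r * q * r' = r * q * g * (g * r').
  by rewrite -!mulrA [g * (g * _)]mulrA gg [q * (g * _)]mulrA qg.
exact: TM.
Qed.

(** The largest two-sided ideal contained in [T]. *)
Definition unit_span_ideal x := forall r r', T (r * x * r').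

Lemma unit_span_idealD x y :
  unit_span_ideal x -> unit_span_ideal y -> unit_span_ideal (x + y).
Proof. by move=> hx hy r r'; rewrite mulrDr mulrDl; exact: TD. Qed.

Lemma unit_span_idealM x a b : unit_span_ideal x -> unit_span_ideal (a * x * b).
Proof. by move=> hx r r'; rewrite !mulrA -mulrA; exact: hx. Qed.

(** The sum of the right ideals [u^(2n) e S], in Horner form so that induction strips off the term
    of degree zero. *)
Inductive even_span u e : S -> Prop :=
| even_span0 : even_span u e 0
| even_spanS r x : even_span u e x -> even_span u e (e * r + u * u * x).

Lemma even_span_rideal u e : rideal (even_span u e).
Proof.
apply: rideal_intro => [|x y hx|x r]; first exact: even_span0.
  elim: hx y => [y|r x' hx' IH y hy]; first by rewrite add0r.
  case: hy => [|r' y' hy'].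
    by rewrite addr0; exact: even_spanS.
  by rewrite addrACA -!mulrDr; apply: even_spanS; exact: IH.
elim=> [|r' x' _ IH]; first by rewrite mul0r; exact: even_span0.
by rewrite mulrDl -!mulrA [u * (u * _)]mulrA; exact: even_spanS.
Qed.

(* [h] is the projection onto the injective hull of [\sum_n u^n e S], which is
   [E0 + u E0] with [E0] the hull of the sum over even [n]. *)
Lemma shift_hull u v : u * v * u = u -> v * u * v = v ->
  (forall r, (1 - v * u) * r * (1 - u * v) = 0) ->
  exists h, [/\ unit_span_ideal h, h * h = h, h * (1 - u * v) = 1 - u * v,
    (1 - h) * u * h = 0 /\ (1 - h) * v * h = 0 &
    forall x, (forall r, x * r * (1 - u * v) = 0) -> x * h = 0].
Proof.
move=> uvu vuv; set e := 1 - u * v; set f := 1 - v * u => fe.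
have eu : e * u = 0 by rewrite mulrBl mul1r uvu subrr.
have ve : v * e = 0 by rewrite mulrBr mulr1 mulrA vuv subrr.
have ee : e * e = e by rewrite {1}/e mulrBl mul1r -mulrA ve mulr0 subr0.
have vuE x : v * u * x = x - f * x by rewrite /f mulrBl mul1r subKr.
clearbody e f.
pose A := even_span u e; pose B : set S := fun x => exists2 y, A y & x = u * y.
have Aid : rideal A := even_span_rideal u e.
have Bid : rideal B.
  apply: rideal_intro => [|_ _ [y Ay ->] [z Az ->]|_ r [y Ay ->]].
  - by exists 0; [exact: even_span0 | rewrite mulr0].
  - by exists (y + z); [exact: ridealD | rewrite mulrDr].
  - by exists (y * r); [exact: ridealM | rewrite mulrA].
(* [f S e = 0] propagates to [A], so [v u] acts as the identity on [A] and on [u A]. *)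
have fA x : A x -> forall r, f * r * x = 0.
  elim=> [r|r' x' _ IH r]; first by rewrite mulr0.
  have -> : f * r * (e * r' + u * u * x') = f * r * e * r' + f * (r * u * u) * x'.
      by rewrite mulrDr !mulrA.
    by rewrite fe IH mul0r addr0.
have vuA x : A x -> v * (u * x) = x.
  by move=> /fA/(_ 1); rewrite mulr1 => fx; rewrite mulrA vuE fx subr0.
have vuuA x : A x -> v * (u * (u * x)) = u * x.
  by move=> /fA/(_ u) fx; rewrite mulrA vuE mulrA fx subr0.
have uuA x : A x -> A (u * (u * x)).
  move=> Ax; rewrite mulrA -[_ * x]add0r -[X in X + _](mulr0 e).
  exact: even_spanS.
have eA r : A (e * r).
  by rewrite -[e * r]addr0 -[X in _ + X](mulr0 (u * u)); apply/even_spanS/even_span0.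
have uI x y : A x -> A y -> u * x = u * y -> x = y.
  by move=> Ax Ay h; rewrite -[x]vuA // h vuA.
have uuI x y : A x -> A y -> u * (u * x) = u * y -> u * x = y.
  by move=> Ax Ay h; rewrite -[u * x]vuuA // h vuA.
have evenE r x y : A x -> A y -> e * r + u * u * x = u * y -> e * r = 0 /\ u * x = y.
  move=> Ax Ay h; have er : e * r = 0.
    have : e * (e * r + u * u * x) = 0 by rewrite h mulrA eu mul0r.
    by rewrite mulrDr !mulrA ee eu !mul0r addr0.
  by split=> //; apply: uuI => //; rewrite -h er add0r mulrA.
(* Equating an even with an odd sum strips the lowest terms alternately from both sides, until one
   side is zero. *)
have AB x : A x -> B x -> x = 0.
  move=> Ax [y]; elim: Ax y => // r x' Ax' IH y Ay.
  case/evenE => // -> xy; rewrite add0r; suff -> : x' = 0 by rewrite mulr0.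
  case: Ay xy => [|r' y' Ay'] xy.
    by apply: uI => //; [exact: even_span0 | rewrite xy mulr0].
  have [er' e2] := evenE r' y' x' Ay' Ax' (esym xy).
  exact: (IH y').
have [h0 [h0A h0B h0M]] := hull Aid Bid AB.
have h0h0 := hull_idempotent h0A h0M.
have h0u : h0 * u * h0 = 0.
  by apply: h0M => x Ax; rewrite -mulrA; apply: h0B; exists x.
have vuh0 : v * u * h0 = h0.
  apply/eqP; rewrite -subr_eq0 -[X in _ - X]mul1r -mulrBl; apply/eqP/h0M => x Ax.
  by rewrite mulrBl mul1r -mulrA vuA // subrr.
(* [u h0] has square zero because [h0] kills [u A]; then [h0 = v (u h0)] is in the ideal too. *)
have Iq : unit_span_ideal (u * h0).
  apply: unit_span_ideal_sqr0.
  by rewrite mulrA -[u * h0 * u]mulrA -[u * _ * _]mulrA h0u mulr0.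
have Ih0 : unit_span_ideal h0.
  by rewrite -vuh0 -mulrA -[_ * _]mulr1; exact: unit_span_idealM.
(* [g] transports the projection [h0] along [u] to [u A]; the factor [1 - h0] makes it vanish on
   [A]. *)
pose g := u * h0 * v * (1 - h0).
have h0g : h0 * g = 0 by rewrite /g !mulrA h0u !mul0r.
have gh0 : g * h0 = 0 by rewrite /g -mulrA mulrBl mul1r h0h0 subrr mulr0.
have gA x : A x -> g * x = 0.
  by move=> Ax; rewrite -[x]h0A // mulrA gh0 mul0r.
have gB x : A x -> g * (u * x) = u * x.
  move=> Ax; rewrite /g -mulrA mulrBl mul1r h0B ?subr0; last by exists x.
  by rewrite -!mulrA vuA // h0A.
have hA x : A x -> (h0 + g) * x = x by move=> Ax; rewrite mulrDl h0A // gA ?addr0.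
have hB x : A x -> (h0 + g) * (u * x) = u * x.
  by move=> Ax; rewrite mulrDl gB // h0B ?add0r //; exists x.
have hM y : (forall x, A x -> y * x = 0) -> (forall x, A x -> y * (u * x) = 0) ->
    y * (h0 + g) = 0.
  move=> yA yB; rewrite mulrDr h0M // /g !mulrA h0M ?mul0r ?addr0 // => x Ax.
  by rewrite -mulrA yB.
exists (h0 + g); split.
- apply: unit_span_idealD => //; rewrite /g -[_ * v * _]mulrA -[u * h0]mul1r.
  exact: unit_span_idealM.
- apply/eqP; rewrite -subr_eq0 -[X in _ - X]mul1r -mulrBl; apply/eqP/hM => x Ax.
    by rewrite mulrBl mul1r hA ?subrr.
  by rewrite mulrBl mul1r hB ?subrr.
- by rewrite -[e]mulr1 hA.
- split; apply: hM => x Ax; rewrite -mulrA mulrBl mul1r.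
  + by rewrite hB ?subrr.
  + by rewrite hA ?subrr //; exact: uuA.
  + case: Ax => [|r y Ay]; first by rewrite !mulr0 subrr.
    by rewrite mulrDr !mulrA ve mul0r add0r -!mulrA vuuA // hB ?subrr.
  + by rewrite vuA // hA ?subrr.
- move=> x xe; have xA y : A y -> forall r, x * r * y = 0.
    elim=> [r|r' y' _ IH r]; first by rewrite mulr0.
    have -> : x * r * (e * r' + u * u * y') = x * r * e * r' + x * (r * u * u) * y'.
      by rewrite mulrDr !mulrA.
    by rewrite xe IH mul0r addr0.
  by apply: hM => y Ay; [have := xA y Ay 1; rewrite mulr1 | rewrite mulrA xA].
Qed.

(** [u] preserves [g S] and has right inverse [v] modulo it; on [g S] itself both factors act as the
    identity or reduce to it. *)
Lemma corner_unit (g u v : S) : g * g = g -> (1 - g) * u * g = 0 ->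
  (1 - g) * u * v = 1 - g -> ((1 - g) * u + g) * ((1 - g) * v + g) = 1.
Proof.
move=> gg ug uv; rewrite mulrDl !mulrDr gg ug addr0 mulrA.
rewrite [_ * (1 - g)]mulrBr mulr1 ug subr0 uv mulrA mulrBr mulr1 gg subrr mul0r.
by rewrite add0r subrK.
Qed.

Lemma unit_span_inner_inverse (a : S) : exists2 x, T x & a = a * x * a.
Proof.
have [c ac] := Sreg a; pose b := c * a * c.
have aba : a * b * a = a by rewrite /b !mulrA -!ac.
have bab : b * a * b = b.
  have -> : b * a * b = c * (a * c * a) * c * a * c by rewrite /b !mulrA.
  by rewrite -ac -[c * a * c * a]mulrA -[c * a * (c * a)]mulrA [a * (c * a)]mulrA -ac.
set e := 1 - b * a; set f := 1 - a * b.
have ae : a * e = 0 by rewrite mulrBr mulr1 mulrA aba subrr.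
have eb : e * b = 0 by rewrite mulrBl mul1r bab subrr.
have bf : b * f = 0 by rewrite mulrBr mulr1 mulrA bab subrr.
have fa : f * a = 0 by rewrite mulrBl mul1r aba subrr.
have ee : e * e = e by rewrite {1}/e mulrBl mul1r -mulrA ae mulr0 subr0.
have ff : f * f = f by rewrite {1}/f mulrBl mul1r -mulrA bf mulr0 subr0.
have [s [t [sE tE sts tst orth]]] := comparability ee ff.
have at0 : a * t = 0 by rewrite tE !mulrA ae !mul0r.
have bs0 : b * s = 0 by rewrite sE !mulrA bf !mul0r.
have ta0 : t * a = 0 by rewrite tE -!mulrA fa !mulr0.
have sb0 : s * b = 0 by rewrite sE -!mulrA eb !mulr0.
(* [s] and [t] act between the complements of [b S] and [a S], so their products with [a] and [b]
   vanish and [a u a = a b a = a]. *)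
pose u := b + t; pose v := a + s.
have uv : u * v = b * a + t * s by rewrite mulrDl !mulrDr bs0 ta0 addr0 add0r.
have vu : v * u = a * b + s * t by rewrite mulrDl !mulrDr at0 sb0 addr0 add0r.
have uvu : u * v * u = u.
  rewrite uv mulrDl !mulrDr -[b * a * t]mulrA at0 mulr0 -[t * s * b]mulrA sb0 mulr0.
  by rewrite bab -tst addr0 add0r.
have vuv : v * u * v = v.
  rewrite vu mulrDl !mulrDr -[a * b * s]mulrA bs0 mulr0 -[s * t * a]mulrA ta0 mulr0.
  by rewrite aba -sts addr0 add0r.
have e0 : 1 - u * v = e - t * s by rewrite uv opprD addrA.
have f0 : 1 - v * u = f - s * t by rewrite vu opprD addrA.
exists u; last first.
  by rewrite mulrDr at0 addr0 aba.
(* Comparability makes the two defects orthogonal; the annihilator property of the hulls carries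
   this over to [h] and [k]. *)
have fe r : (1 - v * u) * r * (1 - u * v) = 0 by rewrite e0 f0.
have ef r : (1 - u * v) * r * (1 - v * u) = 0 by exact: orthogonal_sym.
have [h [Ih hh he [uh vh] hM]] := shift_hull uvu vuv fe.
have [k [Ik kk kf [vk uk] kM]] := shift_hull vuv uvu ef.
have ek r : (1 - u * v) * r * k = 0.
  by apply: kM => r'; rewrite -[_ * r * r']mulrA.
have ke := orthogonal_sym ek.
have hk0 r : h * r * k = 0.
  by apply: orthogonal_sym => {}r; apply: hM => r'; rewrite -[k * r * r']mulrA.
have kh0 := orthogonal_sym hk0.
have hk : h * k = 0 by rewrite -[h]mulr1 hk0.
have kh : k * h = 0 by rewrite -[k]mulr1 kh0.
pose g := h + k.
have gg : g * g = g by rewrite mulrDl !mulrDr hh kk hk kh addr0 add0r.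
have gB w : (1 - h) * w * h = 0 -> (1 - k) * w * k = 0 -> (1 - g) * w * g = 0.
  move=> wh wk; rewrite mulrDr.
  have -> : (1 - g) * w * h = (1 - h) * w * h - k * w * h.
    by rewrite opprD addrA mulrBl mulrBl.
  have -> : (1 - g) * w * k = (1 - k) * w * k - h * w * k.
    by rewrite opprD addrCA addrC mulrBl mulrBl.
  by rewrite wh wk hk0 kh0 subrr addr0.
have Ig : unit_span_ideal g by exact: unit_span_idealD.
have ge : g * (1 - u * v) = 1 - u * v.
  by rewrite mulrDl he -{2}he mulrA kh mul0r addr0.
have gf : g * (1 - v * u) = 1 - v * u.
  by rewrite mulrDl kf -{1}kf mulrA hk mul0r add0r.
have guv : (1 - g) * u * v = 1 - g.
  have /eqP : (1 - g) * (1 - u * v) = 0 by rewrite mulrBl mul1r ge subrr.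
  by rewrite mulrBr mulr1 mulrA subr_eq0 eq_sym => /eqP.
have gvu : (1 - g) * v * u = 1 - g.
  have /eqP : (1 - g) * (1 - v * u) = 0 by rewrite mulrBl mul1r gf subrr.
  by rewrite mulrBr mulr1 mulrA subr_eq0 eq_sym => /eqP.
have Tw : T ((1 - g) * u + g).
  apply: (@Tunit _ ((1 - g) * v + g)); apply: corner_unit => //; exact: gB.
(* [u] differs from a unit by an element of the ideal contained in [T]. *)
have -> : u = (1 - g) * u + g + (g * u - g).
  by rewrite mulrBl mul1r addrACA subrK subrr addr0.
apply: TD => //; apply: TD; first by have := Ig 1 u; rewrite mul1r.
by apply: unit_spanN; have := Ig 1 1; rewrite mul1r mulr1.
Qed.

End RegularSelfInjective.

(** * Units modulo the Jacobson radical *)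

Section JacobsonUnits.
Variable S : pzRingType.
Implicit Types g h x y : S.

(** The right inverse satisfies [y = 1 + x y], so it has a right inverse too, which must equal
    [1 - x]. *)
Lemma one_sub_jacobson_unit x :
  x \in jacobson S -> exists y, (1 - x) * y = 1 /\ y * (1 - x) = 1.
Proof.
move=> xJ; have [y xy] := one_sub_jacobson_rinv xJ; exists y; split=> //.
have [|z yz] := @one_sub_jacobson_rinv S (- (x * y)).
  by rewrite rpredN; exact: tsidealMr.
have {}yz : y * z = 1.
  by rewrite -yz opprK -xy mulrBl mul1r subrK.
by have -> : 1 - x = z by rewrite -[LHS]mulr1 -[X in _ * X]yz mulrA xy mul1r.
Qed.

Lemma unit_of_quot_jacobson g h :
  quot_proj (jacobson S) (g * h) = 1 -> quot_proj (jacobson S) (h * g) = 1 ->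
  exists g', g * g' = 1 /\ g' * g = 1.
Proof.
have lift x : quot_proj (jacobson S) x = 1 -> 1 - x \in jacobson S.
  by move=> xE; rewrite -quot_proj_eq xE rmorph1.
move=> /lift/one_sub_jacobson_unit[y [+ _]] /lift/one_sub_jacobson_unit[z [_]].
rewrite !subKr => ghy zhg; exists (h * y); split; first by rewrite mulrA.
have -> : h * y = z * h by rewrite -[LHS]mul1r -zhg -[RHS]mulr1 -ghy !mulrA.
by rewrite -mulrA.
Qed.

End JacobsonUnits.

(** * Automorphisms and their descent along covers *)

Section EndoUnits.
Variables (R : pzRingType) (M : lmodType R).
Implicit Types f g : endo M.

Lemma endo_unit_bij f g : f * g = 1 -> g * f = 1 -> bijective f.
Proof.
move=> fg gf; exists g => x.
  by rewrite -[LHS]/((g * f) x) gf.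
by rewrite -[LHS]/((f * g) x) fg.
Qed.

Lemma bij_endo_unit f : bijective f -> exists g, f * g = 1 /\ g * f = 1.
Proof.
case=> g fK gK.
have gl : linear g by move=> c u v; apply: (can_inj fK); rewrite linearP !gK.
pose g' : endo M := HB.pack g (GRing.isLinear.Build R M M *:%R g gl).
by exists g'; split; apply: endoP => x; [exact: gK | exact: fK].
Qed.

End EndoUnits.

(** Coinvariance may be witnessed by another cover [p']. Lifting each cover through the other gives
    an isomorphism [h] over [M] with inverse [w h'], and the conjugate of [g] by [h] descends. *)
Lemma coinvariant_descent (R : pzRingType) (XX : lmodType R -> Prop)
    (M X : lmodType R) (p : {linear X -> M}) (g : endo X) :
  is_cover XX p -> automorphism_coinvariant XX M -> bijective g ->
  exists f : endo M, f \o p =1 p \o g.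
Proof.
move=> [[XXX ppre] pmin] [X' [p' [[[XXX' p'pre] p'min] inv]]] gbij.
have [h ph] := p'pre _ p XXX; have [h' ph'] := ppre _ p' XXX'.
have [|w [wl wr]] := @bij_endo_unit _ _ (h' \o h).
  by apply: pmin => x /=; have /= -> := ph' (h x); exact: ph.
have [|w' [w'l _]] := @bij_endo_unit _ _ (h \o h').
  by apply: p'min => x /=; have /= -> := ph (h' x); exact: ph'.
have wE x : w (h' (h x)) = x by rewrite -[LHS]/((w * (h' \o h : endo X)) x) wr.
have w'E x : h (h' (w' x)) = x by rewrite -[LHS]/(((h \o h' : endo X') * w') x) w'l.
have hw x : h (w (h' x)) = x by rewrite -[x]w'E wE.
have [|f fE] := inv (h \o (g \o (w \o h'))).
  by apply: bij_comp; [exists (w \o h') | apply: bij_comp => //; exists h].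
exists f => x /=; have := fE (h x); rewrite /= wE.
by have /= -> := ph x; have /= -> := ph (g x).
Qed.

Theorem theorem4p6 (R : pzRingType) (XX : rmodType R -> Prop)
    (hXX : closed_under_iso XX)
    (M X : rmodType R) (p : {linear X -> M})
    (hp : is_cover XX p) (hepi : epimorphic p)
    (hreg : von_neumann_regular (quot_ring (jacobson (endo X))))
    (hinj : right_self_injective (quot_ring (jacobson (endo X))))
    (hlift : idempotents_lift_modulo (jacobson (endo X)))
    (hM : automorphism_coinvariant XX M) :
  let K := rker (cover_phi hp) in
  [/\ von_neumann_regular (quot_ring K),
      K =i jacobson (endo M)
    & idempotents_lift_modulo (jacobson (endo M))].
Proof.
move=> K; pose J := jacobson (endo X).
pose phi : {rmorphism endo M -> quot_ring J} := cover_phi hp.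
have KE f : (f \in K) = (phi f == 0) by [].
have descent (g g' : endo X) : g * g' = 1 -> g' * g = 1 ->
    exists f : endo M, f \o p =1 p \o g.
  by move=> gg' g'g; apply: (coinvariant_descent hp hM); exact: endo_unit_bij gg' g'g.
have phi_lift (f : endo M) (g : endo X) : f \o p =1 p \o g -> phi f = quot_proj J g.
  by move=> fg; apply: cover_phiE => x; rewrite -fg.
have phi_reg (f : endo M) : exists x, f * x * f - f \in K.
  (* The image of [phi] contains every unit: units lift to automorphisms of [X], which descend to
     [M]. *)
  pose T : set (quot_ring J) := fun a => exists f', phi f' = a.
  have [|||_ [x <-] e] := @unit_span_inner_inverse _ hreg hinj T _ _ _ (phi f).
  - move=> a b; have [g <-] := quot_projP a; have [h <-] := quot_projP b.
    rewrite -!rmorphM => gh hg; have [g' [gg' g'g]] := unit_of_quot_jacobson gh hg.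
    by have [f' /phi_lift f'g] := descent g g' gg' g'g; exists f'.
  - by move=> _ _ [x <-] [y <-]; exists (x + y); rewrite rmorphD.
  - by move=> _ _ [x <-] [y <-]; exists (x * y); rewrite rmorphM.
  by exists x; rewrite KE rmorphB !rmorphM -e subrr.
have KJ f : f \in K -> f \in jacobson (endo M).
  move=> fK; apply: jacobson_quasi_regular => a.
  (* The lift [g] is [1] modulo [J], so it is invertible; its inverse descends to a right inverse of
     [1 - f a], as [p] is onto. *)
  have [g pg] := cover_lift_exists hp (1 - f * a).
  have : quot_proj J g = 1.
    rewrite -(cover_phiE hp pg) -/phi rmorphB rmorphM rmorph1.
    by move: fK; rewrite KE => /eqP ->; rewrite mul0r subr0.
  move=> gE; have [||g' [gg' g'g]] := @unit_of_quot_jacobson _ g 1.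
  - by rewrite mulr1.
  - by rewrite mul1r.
  have [f' f'p] := descent g' g g'g gg'; exists f'; apply: endoP => y.
  have [x <-] := hepi y; rewrite endoME; have /= -> := f'p x.
  have /= <- := pg (g' x); rewrite -[g (g' x)]/((g * g') x) gg'.
  by [].
have JK f : f \in jacobson (endo M) -> f \in K.
  move=> fJ; have [x fxf] := phi_reg f.
  have [y xfy] := one_sub_jacobson_rinv (tsidealMl (t := jacobson _) x fJ).
  (* [f (1 - x f)] lies in [K], and [1 - x f] has right inverse [y] because [f] is in the
     radical. *)
  have -> : f = - ((f * x * f - f) * y).
    have -> : f * x * f - f = - (f * (1 - x * f)) by rewrite mulrBr mulr1 opprB mulrA.
    by rewrite mulNr opprK -mulrA xfy mulr1.
  by rewrite rpredN; exact: tsidealMr.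
split.
- move=> a; have [f <-] := quot_projP a; have [x fxf] := phi_reg f.
  exists (quot_proj K x); apply/esym/eqP.
  have <- : quot_proj K (f * x * f) = quot_proj K f * quot_proj K x * quot_proj K f.
    by rewrite !rmorphM.
  by rewrite quot_proj_eq.
- by move=> f; apply/idP/idP; [exact: KJ | exact: JK].
move=> f /JK ff; have [g pg] := cover_lift_exists hp f.
have fE : phi f = quot_proj J g := cover_phiE hp pg.
have [|e [ee eg]] := hlift g.
  move: ff; rewrite KE rmorphB rmorphM fE -rmorphM subr_eq0.
  by rewrite quot_proj_eq.
(* [e - g \in J] descends to [M] because the unit [1 + (e - g)] does. *)
have [|u [u1 u2]] := @one_sub_jacobson_unit _ (- (e - g)); first by rewrite rpredN.
have [f1 f1p] := descent _ _ u1 u2.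
(* [f] lifts to [g] and [f1 - 1] to [e - g], so [f'] lifts to [e]. *)
pose f' : endo M := f - 1 + f1.
have f'p : f' \o p =1 p \o e.
  move=> x; rewrite -[LHS]/(f (p x) - p x + f1 (p x)).
  have /= -> := f1p x; have /= <- := pg x.
  rewrite -[X in _ + X]/(p (x - - (e x - g x))) opprK !raddfD raddfN /=.
  by rewrite addrA addrNK addrC subrK.
exists f'; split.
  apply: endoP => y; have [x <-] := hepi y; rewrite endoME.
  have /= -> := f'p x; have /= -> := f'p (e x).
  by rewrite -[e (e x)]/((e * e) x) ee.
apply: KJ; rewrite KE rmorphB (phi_lift _ _ f'p) fE subr_eq0.
by rewrite quot_proj_eq.
Qed.
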